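(* Let $y \in (y_{\min}, y_{\max})$, $\delta > 0$ and $t \in T$, let $B_\delta$ be the set attached to $y$ and $\delta$ in the context, and put $$\psi_t(y) := \int_X g\circ\varphi_t \; dP_{\theta^{-1}(y)}.$$ Then for every Borel set $B \subseteq Y$, $$\lim_{n\to\infty} \mu^n\big[\{G_t \in B\} \,\big|\, \{G \in B_\delta\}\big] = \begin{cases} 0, & \text{if } \psi_t(y) \notin \overline{B},\\ 1, & \text{if } \psi_t(y) \in B^\circ,\end{cases}$$ where $\overline{B}$ and $B^\circ$ are the closure and interior of $B$.
   Context: Setting. $(X,d)$ is a complete separable metric space with its Borel $\sigma$-algebra, $\mu$ is a Borel probability measure on $X$, and $\mu^n$ is the $n$-fold product measure on $X^n$. $g: X\to\mathbb{R}$ is measurable, bounded, and continuous $\mu$-almost everywhere. $y_{\min}=\inf g(X)$, $y_{\max}=\sup g(X)$, $Y=[y_{\min},y_{\max}]$, $y_*=\int_X g\,d\mu$. $T\subseteq\mathbb{R}$ is a set of times with $0\in T$; for each $t\in T$, $\varphi_t:X\to X$ is measurable and continuous $\mu$-almost everywhere, and $\varphi_0$ is the identity. For $(x_1,\dots,x_n)\in X^n$: $G(x_1,\dots,x_n)=\frac1n\sum_{i=1}^n g(x_i)$ and $G_t(x_1,\dots,x_n)=\frac1n\sum_{i=1}^n g(\varphi_t(x_i))$ (dependence on $n$ suppressed). Canonical measures. For $\lambda\in\mathbb{R}$, $Z(\lambda)=\int_X e^{\lambda g}\,d\mu$, $\Psi(\lambda)=\log Z(\lambda)$, and $P_\lambda$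 is the probability measure with $dP_\lambda = \frac{e^{\lambda g}}{Z(\lambda)}\,d\mu$. The map $\theta:[-\infty,+\infty]\to Y$ is given by $\theta(\lambda)=\int_X g\,dP_\lambda$ for $\lambda\in\mathbb{R}$, $\theta(-\infty)=y_{\min}$, $\theta(+\infty)=y_{\max}$. For $y\in(y_{\min},y_{\max})$, $\theta^{-1}(y)$ denotes the $\lambda$ satisfying the constraint $\int_X g\,dP_\lambda=y$. (The source obtains the invertibility of $\theta$ from a lemma whose hypothesis is that $\Psi''(\lambda)\neq 0$ for all $\lambda\in\mathbb{R}$.) Conditioning sets. For $y\in(y_{\min},y_{\max})$ and $\delta>0$: $B_\delta=(y-\delta,y]$ if $y<y_*$; $B_\delta=[y,y+\delta)$ if $y>y_*$; $B_\delta=(y_*-\delta,y_*+\delta)$ if $y=y_*$. Conditional probabilities given $\{G\in B_\delta\}$ are considered for $n$ large enough that the conditioning event has positive probability.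
   Formalization: The formal theorem assumes that some real λ satisfies θ(λ)=y; for y in (y_min,y_max) alone θ^{-1}(y) may not exist (e.g. X=[0,3], g(x)=x, μ uniform on {0,1}, y=2), and then ψ_t(y) is undefined. *)

(* Defs.v *)
From HB Require Import structures.
From mathcomp Require Import all_boot all_order all_algebra.
From mathcomp Require Import all_classical all_reals all_analysis.
From mathcomp Require Import measurable_realfun.

Set Implicit Arguments.
Unset Strict Implicit.
Unset Printing Implicit Defensive.

Import Order.TTheory GRing.Theory Num.Theory.
Import numFieldNormedType.Exports.

Local Open Scope classical_set_scope.
Local Open Scope ring_scope.

(* Pointedness comes with the library's complete spaces; it is harmless here,
   since a space that carries a probability measure is nonempty. *)
#[short(type="completeMetricType")]
HB.structure Definition CompleteMetric (R : numDomainType) :=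
  {T of Complete T & PseudoPointedMetric R T & Metric R T}.

Definition separable (T : topologicalType) :=
  exists2 D : set T, countable D & dense D.

(* The carrier of X, equipped with the Borel sigma-algebra. *)
Notation borelType X := (g_sigma_algebraType (@open X)).

(* The n-fold product measure on n-tuples, whose sigma-algebra is generated by
   the coordinate maps: the image of P \x P^n under (x, s) |-> x :: s. *)
Section power_measure.
Context d (T : measurableType d) (R : realType) (P : probability T R).

Definition tuple_cons n (p : T * n.-tuple T) : n.+1.-tuple T :=
  [tuple of p.1 :: p.2].

Lemma measurable_tuple_cons n : measurable_fun setT (@tuple_cons n).
Proof. exact: measurable_cons. Qed.

HB.instance Definition _ n := isMeasurableFun.Build _ _ _ _
  (@tuple_cons n) (@measurable_tuple_cons n).

Fixpoint power_measure n : probability (n.-tuple T) R :=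
  match n with
  | 0 => \d_([tuple] : 0.-tuple T)
  | n.+1 => distribution (P \x power_measure n)%E (@tuple_cons n)
  end.

(* The defining property of the product measure. *)
Lemma power_measure_box n (A : 'I_n -> set T) :
  (forall i, measurable (A i)) ->
  power_measure n [set x | forall i, A i (tnth x i)] = (\prod_i P (A i))%E.
Proof.
elim: n A => [|n IHn] A mA /=.
  by rewrite big_ord0 diracE mem_set// => -[].
rewrite /distribution /pushforward /=.
rewrite (_ : _ @^-1` _ =
  A ord0 `*` [set x | forall i, A (lift ord0 i) (tnth x i)]); last first.
  apply/seteqP; split=> [[x s] /= As|[x s] /= [A0 As] i].
    split; first exact: (As ord0).
    by move=> i; have := As (lift ord0 i); rewrite tnthS.
  by case: (unliftP ord0 i) => [j|] -> //; rewrite tnthS.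
rewrite product_measure1E//; first by
  rewrite big_ord_recl -(IHn (fun i => A (lift ord0 i))).
rewrite (_ : [set _ | _] =
  \bigcap_(i in [set: 'I_n]) (@tnth n T ^~ i @^-1` A (lift ord0 i))); last first.
  by apply/seteqP; split=> x /= Ax i; [move=> _; exact: Ax|exact: Ax].
apply: fin_bigcap_measurable => // i _.
by rewrite -[X in measurable X]setTI; exact: measurable_tnth.
Qed.

End power_measure.

Section canonical_measure.
Context d (T : measurableType d) (R : realType).
Variables (mu : probability T R) (g : {mfun T >-> R}).

Definition partition_function (l : R) : R := \int[mu]_x expR (l * g x).

Definition canonical_measure (l : R) (A : set T) : \bar R :=
  (\int[mu]_(x in A) (expR (l * g x) / partition_function l)%:E)%E.

Let density_ge0 l x : 0 <= expR (l * g x) / partition_function l.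
Proof.
by rewrite divr_ge0 ?expR_ge0// Rintegral_ge0// => ? _; exact: expR_ge0.
Qed.

Let canonical0 l : canonical_measure l set0 = 0%E.
Proof. exact: integral_set0. Qed.

Let canonical_ge0 l A : (0 <= canonical_measure l A)%E.
Proof. by apply: integral_ge0 => x _; rewrite lee_fin density_ge0. Qed.

Let canonical_sigma_additive l : semi_sigma_additive (canonical_measure l).
Proof.
move=> F mF tF mUF; rewrite /canonical_measure ge0_integral_bigcup//=.
- apply: is_cvg_ereal_nneg_natsum_cond => n _ _.
  by apply: integral_ge0 => x _; rewrite lee_fin density_ge0.
- apply: measurable_funTS; apply/measurable_EFinP.
  apply: measurable_funM => //; apply: measurableT_comp => //.
  exact: measurable_funM.
- by move=> x _; rewrite lee_fin density_ge0.
Qed.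

HB.instance Definition _ l := isMeasure.Build _ _ _ (canonical_measure l)
  (canonical0 l) (canonical_ge0 l) (@canonical_sigma_additive l).

(* With g bounded, canonical_measure l is the probability measure P_l. *)
Lemma canonical_measure_setT l :
  (exists M : R, forall x, `|g x| <= M) -> canonical_measure l setT = 1%E.
Proof.
case=> M gM.
have mexp : measurable_fun setT (fun x => expR (l * g x)).
  by apply: measurableT_comp => //; exact: measurable_funM.
have bnd x : `|l * g x| <= `|l| * M by rewrite normrM ler_wpM2l.
have iexp : mu.-integrable setT (EFin \o (fun x => expR (l * g x))).
  apply: (@le_integrable _ _ _ mu _ measurableT _
    (EFin \o cst (expR (`|l| * M)))) => //=.
  - exact/measurable_EFinP.
  - move=> x _; rewrite /= lee_fin !(ger0_norm (expR_ge0 _)) ler_expR.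
    exact: le_trans (ler_norm _) (bnd x).
  - exact: finite_measure_integrable_cst.
have Z0 : 0 < partition_function l.
  apply: (@lt_le_trans _ _ (expR (- (`|l| * M)))); first exact: expR_gt0.
  have -> : expR (- (`|l| * M)) = \int[mu]_x cst (expR (- (`|l| * M))) x.
    by rewrite Rintegral_cst//= probability_setT mulr1.
  rewrite /partition_function le_Rintegral//.
    exact: finite_measure_integrable_cst.
  move=> x _; rewrite /= ler_expR; move: (bnd x).
  by rewrite ler_norml => /andP[].
rewrite /canonical_measure.
under eq_integral do rewrite mulrC EFinM.
rewrite integralZl// -[X in (_ * X)%E]fineK; last exact: integrable_fin_num.
by rewrite -EFinM -/(partition_function l) mulVf// gt_eqF.
Qed.

Definition ymin : R := inf (range g).
Definition ymax : R := sup (range g).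
Definition ystar : R := \int[mu]_x g x.

Definition theta (l : \bar R) : R :=
  match l with
  | l%:E => \int[canonical_measure l]_x g x
  | +oo%E => ymax
  | -oo%E => ymin
  end.

(* [get] picks an element of the set; it is meaningful only when y is
   attained. *)
Definition theta_inv (y : R) : R := get [set l : R | theta l%:E = y].

Definition psi (phi_t : T -> T) (y : R) : R :=
  \int[canonical_measure (theta_inv y)]_x g (phi_t x).

Definition Bdelta (y delta : R) : set R :=
  if y < ystar then `]y - delta, y]%classic
  else if ystar < y then `[y, y + delta[%classic
  else `]ystar - delta, ystar + delta[%classic.

End canonical_measure.

Definition empirical_mean (T : Type) (R : realType) (f : T -> R) n
  (x : n.-tuple T) : R := (\sum_(i < n) f (tnth x i)) / n%:R.

(* P(A | C), with value 0 when P C = 0. *)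
Definition cond_prob d (T : measurableType d) (R : realType)
  (P : probability T R) (A C : set T) : R := fine (P (A `&` C)) / fine (P C).

(* Main.v *)
Require Import Defs.
From HB Require Import structures.
From mathcomp Require Import all_boot all_order all_algebra.
From mathcomp Require Import all_classical all_reals all_analysis.
From mathcomp Require Import measurable_realfun.
From mathcomp Require Import ring lra.

Set Implicit Arguments.
Unset Strict Implicit.
Unset Printing Implicit Defensive.

Import Order.TTheory GRing.Theory Num.Theory.
Import numFieldNormedType.Exports.

Local Open Scope classical_set_scope.
Local Open Scope ring_scope.

(** Let [l] be the parameter with [theta l = y], and let [S] and [U] be the
    sums over the [n] coordinates of [f = sg (g - y)], where [sg] is the sign
    of [y - ystar], and of [g \o phi t - psi]. Both [f] and [g \o phi t - psi]
    are centered under the canonical measure, whose density is, up to a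
    constant, [exp (k f)] with [k = sg l >= 0].
    The conditioning event is [0 <= S < n delta], so [exp (k S) >= 1] on it and
    [mu^n(|U| >= n e, 0 <= S < n delta) <= E[exp (k S); |U| >= n e], which by
    Chernoff's bound is at most [2 W^n exp (- c n)] with [W = E(exp (k f))].
    Conversely Jensen's inequality gives [E(exp (k S) S^+) >= const W^n], the
    part [S >= n eta] of this expectation is again exponentially smaller than
    [W^n], and on the part [0 <= S < n eta] the integrand is at most
    [n M exp (k eta n)]; hence [mu^n(0 <= S < n delta)] is at least
    [const W^n exp (- k eta n) / n], and [eta] can be taken so small that
    [k eta < c]. When [y = ystar] the canonical measure is [mu] itself and
    Chernoff's bound alone, with [k = 0], suffices. *)

(** * Sums over tuples and integrals against the product measure *)

Section tuple_sum.
Context d (T : measurableType d) (R : realType).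
Implicit Types f : T -> R.

Definition tuple_sum f n (x : n.-tuple T) : R := \sum_(i < n) f (tnth x i).

Lemma tuple_sum0 f (x : 0.-tuple T) : tuple_sum f x = 0.
Proof. exact: big_ord0. Qed.

Lemma tuple_sum_cons f n (p : T * n.-tuple T) :
  tuple_sum f (tuple_cons p) = f p.1 + tuple_sum f p.2.
Proof.
rewrite /tuple_sum big_ord_recl tnth0; congr (_ + _).
by apply: eq_bigr => i _; rewrite tnthS.
Qed.

Lemma measurable_tuple_sum f n :
  measurable_fun setT f -> measurable_fun setT (@tuple_sum f n).
Proof.
move=> mf; apply: measurable_sum => i.
by apply: measurableT_comp => //; exact: measurable_tnth.
Qed.

Lemma norm_tuple_sum f M n (x : n.-tuple T) : (forall z, `|f z| <= M) ->
  `|tuple_sum f x| <= n%:R * M.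
Proof.
move=> fM; apply: (le_trans (ler_norm_sum _ _ _)).
rewrite (le_trans (ler_sum _ (fun i _ => fM (tnth x i))))//.
by rewrite sumr_const card_ord mulr_natl.
Qed.

End tuple_sum.
Arguments tuple_sum {d T R} f {n} x.

Section bounded_functions.
Context d (T : measurableType d) (R : realType) (P : probability T R).
Implicit Types f : T -> R.

(** Closed under all the operations needed below, and every member is integrable for every
    probability measure; integrability is thus never checked by hand. *)
Definition bounded_measurable f :=
  measurable_fun setT f /\ exists M, forall x, `|f x| <= M.

Lemma bounded_measurable_integrable f :
  bounded_measurable f -> P.-integrable setT (EFin \o f).
Proof.
move=> [mf [M fM]]; apply: measurable_bounded_integrable => //.
  by rewrite -ge0_fin_numE// fin_num_measure.
by exists M; split; [exact: num_real|move=> r Mr x _; exact: le_trans (fM x) (ltW Mr)].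
Qed.

Lemma bounded_measurable_cst c : bounded_measurable (cst c).
Proof. by split => //; exists `|c|. Qed.

Lemma bounded_measurableD f g : bounded_measurable f -> bounded_measurable g ->
  bounded_measurable (fun x => f x + g x).
Proof.
move=> [mf [M fM]] [mg [N gN]]; split; first exact: measurable_funD.
by exists (M + N) => x; rewrite (le_trans (ler_normD _ _))// lerD.
Qed.

Lemma bounded_measurableM f g : bounded_measurable f -> bounded_measurable g ->
  bounded_measurable (fun x => f x * g x).
Proof.
move=> [mf [M fM]] [mg [N gN]]; split; first exact: measurable_funM.
by exists (M * N) => x; rewrite normrM ler_pM.
Qed.

Lemma bounded_measurableZ c f : bounded_measurable f ->
  bounded_measurable (fun x => c * f x).
Proof. by move=> bf; exact: (bounded_measurableM (bounded_measurable_cst c)). Qed.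

Lemma bounded_measurableN f : bounded_measurable f ->
  bounded_measurable (fun x => - f x).
Proof.
by move=> [mf [M fM]]; split;
  [exact: measurableT_comp|exists M => x; rewrite normrN].
Qed.

Lemma bounded_measurable_expR f : bounded_measurable f ->
  bounded_measurable (fun x => expR (f x)).
Proof.
move=> [mf [M fM]]; split; first exact: measurableT_comp.
exists (expR M) => x; rewrite ger0_norm ?expR_ge0// ler_expR.
exact: le_trans (ler_norm _) (fM x).
Qed.

Lemma bounded_measurable_max0 f : bounded_measurable f ->
  bounded_measurable (fun x => Num.max (f x) 0).
Proof.
move=> [mf [M fM]]; split; first exact: measurable_maxr.
exists M => x; have := fM x; case: (leP (f x) 0) => // _.
by rewrite normr0; exact: le_trans.
Qed.

Lemma bounded_measurable_le_Rintegral f g :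
  bounded_measurable f -> bounded_measurable g -> (forall x, f x <= g x) ->
  \int[P]_x f x <= \int[P]_x g x.
Proof.
by move=> bf bg fg; apply: le_Rintegral => //;
  exact: bounded_measurable_integrable.
Qed.

Lemma bounded_measurable_RintegralD f g :
  bounded_measurable f -> bounded_measurable g ->
  \int[P]_x (f x + g x) = \int[P]_x f x + \int[P]_x g x.
Proof.
by move=> bf bg; rewrite RintegralD//; exact: bounded_measurable_integrable.
Qed.

Lemma bounded_measurable_RintegralZ c f : bounded_measurable f ->
  \int[P]_x (c * f x) = c * \int[P]_x f x.
Proof.
by move=> bf; rewrite RintegralZl//; exact: bounded_measurable_integrable.
Qed.

Lemma bounded_measurable_EFin_Rintegral f : bounded_measurable f ->
  (\int[P]_x (f x)%:E = (\int[P]_x f x)%:E)%E.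
Proof.
move=> bf; rewrite /Rintegral fineK//; apply: integrable_fin_num => //.
exact: bounded_measurable_integrable.
Qed.

Lemma Rintegral_probability_cst c : \int[P]_x (cst c x) = c.
Proof. by rewrite Rintegral_cst//= probability_setT mulr1. Qed.

Lemma bounded_measurable_Rintegral_expR_gt0 f : bounded_measurable f ->
  0 < \int[P]_x expR (f x).
Proof.
move=> [mf [M fM]]; apply: (@lt_le_trans _ _ (\int[P]_x (cst (expR (- M)) x))).
  by rewrite Rintegral_probability_cst expR_gt0.
apply: bounded_measurable_le_Rintegral.
- exact: bounded_measurable_cst.
- by apply: bounded_measurable_expR; split => //; exists M.
- by move=> x; rewrite ler_expR; have := fM x; rewrite ler_norml => /andP[].
Qed.

End bounded_functions.

Section power_measure_integral.
Context d (T : measurableType d) (R : realType) (P : probability T R).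
Implicit Types k f : T -> R.

Lemma ge0_integral_power_measureZ n c (F : n.-tuple T -> \bar R) :
  measurable_fun setT F -> (forall x, 0 <= F x)%E -> 0 <= c ->
  (\int[power_measure P n]_x (c%:E * F x) =
   c%:E * \int[power_measure P n]_x F x)%E.
Proof. by move=> mF F0 c0; rewrite ge0_integralZl. Qed.

Lemma ge0_integral_power_measure0 (F : 0.-tuple T -> \bar R) :
  measurable_fun setT F -> (\int[power_measure P 0]_x F x = F [tuple])%E.
Proof. by move=> mF; rewrite /= integral_dirac// diracT mul1e. Qed.

Lemma ge0_integral_power_measureS n (F : n.+1.-tuple T -> \bar R) :
  measurable_fun setT F -> (forall x, 0 <= F x)%E ->
  (\int[power_measure P n.+1]_x F x =
   \int[P]_z \int[power_measure P n]_s F (tuple_cons (z, s)))%E.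
Proof.
move=> mF F0; rewrite /= ge0_integral_distribution// fubini_tonelli1//=.
exact: measurableT_comp.
Qed.

(** Independence of the coordinates: the exponential of a sum factors, and Tonelli's theorem splits
    off one coordinate at a time. *)
Lemma integral_power_measure_expR k n : bounded_measurable k ->
  (\int[power_measure P n]_x (expR (tuple_sum k x))%:E =
   ((\int[P]_x expR (k x)) ^+ n)%:E)%E.
Proof.
move=> bk; have mk := bk.1.
have mE m : measurable_fun setT (fun x : m.-tuple T => (expR (tuple_sum k x))%:E).
  by apply/measurable_EFinP/measurableT_comp => //; exact: measurable_tuple_sum.
elim: n => [|n IHn].
  by rewrite ge0_integral_power_measure0// tuple_sum0 expR0 expr0.
rewrite ge0_integral_power_measureS//.
have inner z : (\int[power_measure P n]_s
    (expR (tuple_sum k (tuple_cons (z, s))))%:E =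
    ((\int[P]_x expR (k x)) ^+ n * expR (k z))%:E)%E.
  under eq_integral => s _ do rewrite tuple_sum_cons/= expRD EFinM.
  by rewrite ge0_integral_power_measureZ ?expR_ge0// IHn -EFinM mulrC.
under eq_integral do rewrite inner.
rewrite bounded_measurable_EFin_Rintegral; last first.
  exact/bounded_measurableZ/bounded_measurable_expR.
rewrite bounded_measurable_RintegralZ; last exact: bounded_measurable_expR.
by rewrite exprSr.
Qed.

Section expR_max.
Variables k f : T -> R.
Hypotheses (bk : bounded_measurable k) (bf : bounded_measurable f).

Let W := \int[P]_x expR (k x).

(** The shift [c] stands for the part of the sum carried by coordinates already split off; it has to
    vary in the induction on [n]. *)
Let I n c := (\int[power_measure P n]_x
  (expR (tuple_sum k x) * Num.max (c + tuple_sum f x) 0)%:E)%E.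

Let mE m c : measurable_fun setT (fun x : m.-tuple T =>
  (expR (tuple_sum k x) * Num.max (c + tuple_sum f x) 0)%:E).
Proof.
apply/measurable_EFinP/measurable_funM.
  by apply/measurableT_comp => //; exact: measurable_tuple_sum bk.1.
apply: measurable_maxr => //; apply: measurable_funD => //.
exact: measurable_tuple_sum bf.1.
Qed.

Let E0 m c (x : m.-tuple T) :
  (0 <= (expR (tuple_sum k x) * Num.max (c + tuple_sum f x) 0)%:E)%E.
Proof. by rewrite lee_fin mulr_ge0 ?expR_ge0// le_max lexx orbT. Qed.

Let W0 : 0 < W. Proof. exact: bounded_measurable_Rintegral_expR_gt0. Qed.

Let bc c : bounded_measurable (fun x => expR (k x) * Num.max (c + f x) 0).
Proof.
apply: bounded_measurableM; first exact: bounded_measurable_expR.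
apply/bounded_measurable_max0/bounded_measurableD => //.
exact: bounded_measurable_cst.
Qed.

(** With the first coordinate fixed at [z], the inner integral is [expR (k z) * I n (c + f z)], to
    which the assumed bound applies. *)
Let I_cons n c : (forall c, (W ^+ n * Num.max c 0)%:E <= I n c)%E ->
  ((W ^+ n * \int[P]_x (expR (k x) * Num.max (c + f x) 0))%:E <= I n.+1 c)%E.
Proof.
move=> In; rewrite /I ge0_integral_power_measureS//.
rewrite -bounded_measurable_RintegralZ//.
rewrite -bounded_measurable_EFin_Rintegral; last exact: bounded_measurableZ.
apply: ge0_le_integral => //.
- move=> z _; rewrite lee_fin !mulr_ge0 ?exprn_ge0 ?(ltW W0) ?expR_ge0//.
  by rewrite le_max lexx orbT.
- apply/measurable_EFinP; exact: (bounded_measurableZ _ (bc c)).1.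
- apply: (@measurable_fun_fubini_tonelli_F _ _ _ _ _ (power_measure P n)
    (fun p => (expR (tuple_sum k (tuple_cons p)) *
               Num.max (c + tuple_sum f (tuple_cons p)) 0)%:E)) => //.
  exact: (measurableT_comp (@mE n.+1 c) (@measurable_tuple_cons _ _ n)).
- move=> z _.
  rewrite (_ : (fun _ => _) = (fun s => (expR (k z))%:E *
      (expR (tuple_sum k s) * Num.max (c + f z + tuple_sum f s) 0)%:E)%E).
    rewrite ge0_integral_power_measureZ ?expR_ge0//.
    by rewrite mulrCA EFinM lee_pmul2l ?lte_fin ?expR_gt0//; exact: In.
  by apply/funext => s; rewrite !tuple_sum_cons/= expRD addrA -mulrA EFinM.
Qed.

Hypothesis kf0 : \int[P]_x (expR (k x) * f x) = 0.

(* Jensen's inequality for the convex function [s |-> (c + s)^+], one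
   coordinate at a time. *)
Let I_ge n c : ((W ^+ n * Num.max c 0)%:E <= I n c)%E.
Proof.
elim: n c => [|n IHn] c.
  by rewrite /I ge0_integral_power_measure0// !tuple_sum0 expR0 expr0 addr0.
apply: le_trans (I_cons c IHn).
rewrite lee_fin exprSr -mulrA ler_wpM2l ?exprn_ge0 ?(ltW W0)//.
rewrite maxr_pMr ?(ltW W0)// mulr0 ge_max; apply/andP; split; last first.
  apply: Rintegral_ge0 => x _.
  by rewrite mulr_ge0 ?expR_ge0// le_max lexx orbT.
have bce : bounded_measurable (fun x => c * expR (k x)).
  exact/bounded_measurableZ/bounded_measurable_expR.
have bef : bounded_measurable (fun x => expR (k x) * f x).
  by apply: bounded_measurableM => //; exact: bounded_measurable_expR.
(* By [kf0] the added term has integral zero, and [c + f x] lies below its positive part. *)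
have -> : W * c = \int[P]_x (c * expR (k x) + expR (k x) * f x).
  rewrite bounded_measurable_RintegralD//.
  rewrite bounded_measurable_RintegralZ; last exact: bounded_measurable_expR.
  by rewrite kf0 addr0 mulrC.
apply: bounded_measurable_le_Rintegral => //; first exact: bounded_measurableD.
move=> x; rewrite [c * _]mulrC -mulrDr ler_wpM2l ?expR_ge0//.
by rewrite le_max lexx.
Qed.

(** Jensen's inequality on all [n.+1] coordinates would only give the bound zero. It is therefore
    applied to [n] of them, and the remaining one keeps its full integral, which is positive in the
    applications. *)
Lemma integral_power_measure_expR_max_ge n :
  ((W ^+ n * \int[P]_x (expR (k x) * Num.max (f x) 0))%:E <=
   \int[power_measure P n.+1]_x
     (expR (tuple_sum k x) * Num.max (tuple_sum f x) 0)%:E)%E.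
Proof.
have := I_cons 0 (I_ge n); rewrite /I.
under eq_Rintegral do rewrite add0r.
by under eq_integral do rewrite add0r.
Qed.

End expR_max.

End power_measure_integral.

(** * Chernoff's bound *)

Section real_estimates.
Context (R : realType).
Implicit Types x c : R.

(** From [1 - x <= expR (- x)] one gets [expR x * (1 - x) <= 1], while the right-hand side times
    [1 - x] is [1 + x ^+ 2 * (1 - 2 * x) >= 1]. *)
Lemma expR_le_quadratic x : `|x| <= 1 / 2 -> expR x <= 1 + x + 2 * x ^+ 2.
Proof.
rewrite ler_norml => /andP[x1 x2].
have h : 1 - x <= expR (- x) by exact: expR_ge1Dx.
have h1 : expR x * expR (- x) = 1 by rewrite expRxMexpNx_1.
have h0 := expR_gt0 x.
have h2 : expR x * (1 - x) <= 1 by rewrite -[leRHS]h1 ler_pM2l.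
rewrite -(@ler_pM2r _ (1 - x)); last lra.
apply: (le_trans h2).
rewrite -subr_ge0.
have -> : (1 + x + 2 * x ^+ 2) * (1 - x) - 1 = x ^+ 2 * (1 - 2 * x) by ring.
by rewrite mulr_ge0 ?sqr_ge0//; lra.
Qed.

(** Since [expR (c * n) >= (c * n) ^+ 2 / 2], the sequence is at most [2 / (c ^+ 2 * n)] for
    [n > 0]. *)
Lemma cvgn_natmul_expR c : 0 < c -> n%:R * expR (- c) ^+ n @[n --> \oo] --> (0 : R).
Proof.
move=> c0; rewrite -cvg_shiftS/=.
apply: (@squeeze_cvgr _ _ _ _ (cst 0) (fun n => 2 / c ^+ 2 * @harmonic R n)).
- near=> n; rewrite mulr_ge0 ?exprn_ge0 ?expR_ge0//=.
  rewrite -expRM_natr mulNr expRN ler_pdivrMr ?expR_gt0//.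
  set N : R := n.+1%:R; have N0 : 0 < N by rewrite ltr0n.
  have := @expR_ge1Dxn R (c * N) 1 (mulr_ge0 (ltW c0) (ltW N0)).
  rewrite (_ : (2`!)%:R = 2 :> R)// => h.
  apply: (@le_trans _ _ (2 / c ^+ 2 / N * ((c * N) ^+ 2 / 2))).
    rewrite le_eqVlt; apply/orP; left; apply/eqP; field.
    by rewrite !gt_eqF.
  rewrite ler_wpM2l//; first by rewrite !divr_ge0 ?exprn_ge0// ltW.
  by apply: le_trans h; rewrite lerDr.
- exact: cvg_cst.
- rewrite -[X in _ --> X](mulr0 (2 / c ^+ 2)).
  by apply: cvgMr; exact: cvg_harmonic.
Unshelve. all: by end_near. Qed.

(** Comparison of exponential rates: [a n] is the probability of the deviation together with the
    conditioning event, [D n] that of the conditioning event. The [c'] term is negligible against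
    [W ^+ n], so [D n] is at least [q / 2 * (W * expR (- l)) ^+ n / n], and the ratio is at most
    [4 / q * n * expR (- (c - l)) ^+ n]. *)
Lemma ratio_cvg0 (a D : nat -> R) (W q l c c' : R) :
  0 < W -> 0 < q -> l < c -> 0 < c' ->
  (forall n, 0 <= a n <= 2 * (W * expR (- c)) ^+ n) ->
  (forall n, q * W ^+ n.+1 <=
    n.+1%:R * (expR l ^+ n.+1 * D n.+1 + 2 * (W * expR (- c')) ^+ n.+1)) ->
  (\forall n \near \oo, 0 < D n) /\ a n / D n @[n --> \oo] --> 0.
Proof.
move=> W0 q0 lc c'0 ha hD.
have cl0 : 0 < c - l by rewrite subr_gt0.
have key : \forall n \near \oo,
    q / 2 * W ^+ n <= n%:R * expR l ^+ n * D n /\ (0 < n)%N.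
  have := cvgn_natmul_expR c'0.
  move=> /(@cvgr_lt _ _ _ _ _ 0)/(_ _ (divr_gt0 q0 (ltr0n _ 4))) => hn.
  near=> n.
  have n0 : (0 < n)%N by near: n; exact: nbhs_infty_gt.
  split => //.
  (* With the factor 2 of the tail term, this uses up half of [q] and leaves [q / 2]. *)
  have hn' : n%:R * expR (- c') ^+ n < q / 4 by near: n.
  have := hD n.-1; rewrite (prednK n0) exprMn => h.
  have Wn : 0 < W ^+ n by rewrite exprn_gt0.
  have : n%:R * expR (- c') ^+ n * W ^+ n <= q / 4 * W ^+ n.
    by rewrite ler_wpM2r ?ltW.
  move: h; nra.
have Dpos n : (0 < n)%N -> q / 2 * W ^+ n <= n%:R * expR l ^+ n * D n -> 0 < D n.
  move=> n0 h; rewrite -(@pmulr_rgt0 _ (n%:R * expR l ^+ n)).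
    by apply: lt_le_trans h; rewrite !mulr_gt0 ?exprn_gt0.
  by rewrite mulr_gt0 ?ltr0n// exprn_gt0// expR_gt0.
split.
  by near=> n; have [] : q / 2 * W ^+ n <= n%:R * expR l ^+ n * D n /\ (0 < n)%N
    by [near: n]; move=> ? ?; exact: Dpos.
apply: (@squeeze_cvgr _ _ _ _ (cst 0)
    (fun n => 4 / q * (n%:R * expR (- (c - l)) ^+ n))); last 2 first.
- exact: cvg_cst.
- rewrite -[X in _ --> X](mulr0 (4 / q)).
  by apply: cvgMr; exact: cvgn_natmul_expR.
near=> n.
have [h n0] : q / 2 * W ^+ n <= n%:R * expR l ^+ n * D n /\ (0 < n)%N.
  by near: n.
have D0 := Dpos _ n0 h.
have /andP[a0 an] := ha n.
rewrite divr_ge0 ?(ltW D0)//=.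
rewrite ler_pdivrMr//; apply: (le_trans an).
rewrite opprB addrC expRD !exprMn.
have := ler_wpM2r (mulr_ge0 (divr_ge0 (ler0n R 4) (ltW q0))
  (exprn_ge0 n (expR_ge0 (- c)))) h.
set E := expR (- c) ^+ n; set L := expR l ^+ n.
have -> : q / 2 * W ^+ n * (4 / q * E) = 2 * (W ^+ n * E) by field; rewrite gt_eqF.
by move=> /le_trans; apply; rewrite le_eqVlt; apply/orP; left; apply/eqP; ring.
Unshelve. all: by end_near. Qed.

End real_estimates.

Section exponential_tail.
Context d (T : measurableType d) (R : realType) (P : probability T R).
Implicit Types k u : T -> R.

(** Chernoff's bound for one coordinate: expanding [expR (s * u x)] to second order, the linear term
    vanishes by [ku0], and [1 + 2 * (s * M) ^+ 2 <= expR (2 * (s * M) ^+ 2)], whose exponent is at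
    most [s * eps / 2]. *)
Lemma Rintegral_expR_tilt_le k u (M s eps : R) :
  bounded_measurable k -> bounded_measurable u -> (forall x, `|u x| <= M) ->
  \int[P]_x (expR (k x) * u x) = 0 ->
  0 <= s -> s * M <= 1 / 2 -> 4 * s * M ^+ 2 <= eps ->
  \int[P]_x expR (k x + s * (u x - eps)) <=
  (\int[P]_x expR (k x)) * expR (- (s * eps / 2)).
Proof.
move=> bk bu uM ku0 s0 sM1 sM2.
have be := bounded_measurable_expR bk.
have beu := bounded_measurableM be bu.
set W := \int[P]_x expR (k x).
have W0 : 0 < W by exact: bounded_measurable_Rintegral_expR_gt0.
set C := 1 + 2 * (s * M) ^+ 2.
apply: (@le_trans _ _ (\int[P]_x (expR (- (s * eps)) *
    (C * expR (k x) + s * (expR (k x) * u x))))).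
  apply: bounded_measurable_le_Rintegral.
  - apply/bounded_measurable_expR/bounded_measurableD => //.
    apply/bounded_measurableZ/bounded_measurableD => //.
    exact: bounded_measurable_cst.
  - by apply/bounded_measurableZ/bounded_measurableD; exact: bounded_measurableZ.
  move=> x.
  have -> : k x + s * (u x - eps) = - (s * eps) + (k x + s * u x) by ring.
  rewrite !expRD ler_pM2l ?expR_gt0//.
  have -> : C * expR (k x) + s * (expR (k x) * u x) =
    expR (k x) * (C + s * u x) by ring.
  rewrite ler_pM2l ?expR_gt0//.
  have sux : `|s * u x| <= s * M by rewrite normrM (ger0_norm s0) ler_wpM2l.
  apply: (le_trans (expR_le_quadratic (le_trans sux sM1))).
  have : (s * u x) ^+ 2 <= (s * M) ^+ 2.
    by rewrite -real_normK ?num_real// ler_pXn2r ?nnegrE// (le_trans _ sux).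
  rewrite /C; lra.
rewrite bounded_measurable_RintegralZ; last first.
  by apply/bounded_measurableD; exact: bounded_measurableZ.
rewrite bounded_measurable_RintegralD; try exact: bounded_measurableZ.
rewrite !bounded_measurable_RintegralZ// ku0 mulr0 addr0 -/W.
set e := expR (- (s * eps)); have -> : e * (C * W) = W * (C * e) by ring.
rewrite ler_pM2l//.
apply: (le_trans (ler_wpM2r (expR_ge0 _) (expR_ge1Dx _))).
rewrite -expRD ler_expR.
have := ler_wpM2l s0 sM2; rewrite exprMn expr2; nra.
Qed.

(** The indicator is at most the sum of the exponentials of [s * (U - n * eps)] and
    [s * (- U - n * eps)], where [U] is the sum of [u]. Their tilted integrals are [n]-th powers of
    one-coordinate integrals; the two signs account for the factor 2. *)
Lemma integral_power_measure_tail k u (eps : R) :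
  bounded_measurable k -> bounded_measurable u -> 0 < eps ->
  \int[P]_x (expR (k x) * u x) = 0 ->
  exists2 c : R, 0 < c & forall n,
    (\int[power_measure P n]_x (expR (tuple_sum k x) *
       \1_[set x : n.-tuple T | (n%:R * eps <= `|tuple_sum u x|)%R] x)%:E <=
     (2 * ((\int[P]_x expR (k x)) * expR (- c)) ^+ n)%:E)%E.
Proof.
move=> bk bu eps0 ku0.
have [M M0 uM] : exists2 M, 0 < M & forall x, `|u x| <= M.
  have [M uM] := bu.2; exists (`|M| + 1); first by rewrite ltr_wpDl.
  by move=> x; rewrite (le_trans (uM x))// (le_trans (ler_norm _))// lerDl.
(* The largest [s] that meets both smallness conditions of [Rintegral_expR_tilt_le]. *)
pose s := Num.min (1 / 2 / M) (eps / (4 * M ^+ 2)).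
have s0 : 0 < s by rewrite lt_min !divr_gt0// mulr_gt0// exprn_gt0.
have sM1 : s * M <= 1 / 2 by rewrite -ler_pdivlMr// ge_min lexx.
have sM2 : 4 * s * M ^+ 2 <= eps.
  have : s <= eps / (4 * M ^+ 2) by rewrite ge_min lexx orbT.
  rewrite ler_pdivlMr ?mulr_gt0 ?exprn_gt0//; lra.
exists (s * eps / 2); first by rewrite divr_gt0// mulr_gt0.
move=> n.
pose kp x := k x + s * (u x - eps).
pose km x := k x + s * (- u x - eps).
have bNu := bounded_measurableN bu.
have bkp : bounded_measurable kp.
  apply/bounded_measurableD/bounded_measurableZ/bounded_measurableD => //.
  exact: bounded_measurable_cst.
have bkm : bounded_measurable km.
  apply/bounded_measurableD/bounded_measurableZ/bounded_measurableD => //.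
  exact: bounded_measurable_cst.
set W := \int[P]_x expR (k x).
have Wp : \int[P]_x expR (kp x) <= W * expR (- (s * eps / 2)).
  by apply: (@Rintegral_expR_tilt_le k u M) => //; exact: ltW.
have Wm : \int[P]_x expR (km x) <= W * expR (- (s * eps / 2)).
  apply: (@Rintegral_expR_tilt_le k (fun x => - u x) M) => //.
  - by move=> x; rewrite normrN.
  - under eq_Rintegral do rewrite mulrN -mulN1r.
    rewrite bounded_measurable_RintegralZ ?ku0 ?mulr0//.
    by apply: bounded_measurableM => //; exact: bounded_measurable_expR.
  - exact: ltW.
have mS (h : T -> R) : measurable_fun setT h ->
    measurable_fun setT (fun x : n.-tuple T => (expR (tuple_sum h x))%:E).
  move=> mh; apply/measurable_EFinP/measurableT_comp => //.
  exact: measurable_tuple_sum.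
have sumE (v : T -> R) (x : n.-tuple T) :
    tuple_sum (fun z => k z + s * (v z - eps)) x =
    tuple_sum k x + s * (tuple_sum v x - n%:R * eps).
  rewrite /tuple_sum big_split/= -mulr_sumr; congr (_ + _ * _).
  by rewrite sumrB sumr_const card_ord mulr_natl.
apply: (@le_trans _ _ (\int[power_measure P n]_x
    ((expR (tuple_sum kp x))%:E + (expR (tuple_sum km x))%:E))%E).
  apply: ge0_le_integral => //.
  - apply/measurable_EFinP/measurable_funM.
      by apply/measurableT_comp => //; exact: measurable_tuple_sum bk.1.
    apply/measurable_indicP.
    rewrite -[X in measurable X]setTI.
    apply: (@measurable_fun_ler _ _ _ setT (cst (n%:R * eps))) => //.
    by apply/measurableT_comp => //; exact: measurable_tuple_sum bu.1.
  - by apply: emeasurable_funD; apply: mS; [exact: bkp.1|exact: bkm.1].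
  move=> x _; rewrite -EFinD lee_fin.
  rewrite indicE; case: (boolP (_ \in _)) => [|_]; last first.
    by rewrite mulr0 addr_ge0 ?expR_ge0.
  rewrite inE/= mulr1 => hx.
  have Nu : tuple_sum (fun z => - u z) x = - tuple_sum u x.
    by rewrite /tuple_sum sumrN.
  have [u0|u0] := leP 0 (tuple_sum u x).
    rewrite -[leLHS]addr0 lerD ?expR_ge0// ler_expR sumE lerDl.
    by rewrite mulr_ge0 ?(ltW s0)// subr_ge0 -(ger0_norm u0).
  rewrite -[leLHS]add0r lerD ?expR_ge0// ler_expR (sumE (fun z => - u z)) lerDl.
  by rewrite mulr_ge0 ?(ltW s0)// subr_ge0 Nu -(ltr0_norm u0).
rewrite ge0_integralD//; try by apply: mS; [exact: bkp.1||exact: bkm.1].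
rewrite !integral_power_measure_expR// -EFinD lee_fin mulr_natl mulr2n.
have W0 v : 0 <= \int[P]_x expR (v x).
  by apply: Rintegral_ge0 => x _; exact: expR_ge0.
by rewrite lerD// lerXn2r// nnegrE ?mulr_ge0 ?expR_ge0// W0.
Qed.

End exponential_tail.

(** * Concentration under a tilted conditioning *)

Section concentration.
Context d (T : measurableType d) (R : realType) (P : probability T R).
Variables (f u : T -> R).
Hypotheses (bf : bounded_measurable f) (bu : bounded_measurable u).

Lemma measurable_tuple_sum_preimage n (h : T -> R) (D : set R) :
  measurable_fun setT h -> measurable D ->
  measurable [set x : n.-tuple T | D (tuple_sum h x)].
Proof.
move=> mh mD; rewrite -[X in measurable X]setTI.
exact: measurable_tuple_sum.
Qed.

Lemma measurable_tuple_sum_tail n (h : T -> R) (e : R) :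
  measurable_fun setT h ->
  measurable [set x : n.-tuple T | n%:R * e <= `|tuple_sum h x|].
Proof.
move=> mh.
apply: (measurable_tuple_sum_preimage (D := [set r | n%:R * e <= `|r|])) => //.
rewrite -[X in measurable X]setTI.
exact: (@measurable_fun_ler _ _ _ setT (cst (n%:R * e))).
Qed.

Let A (h : T -> R) e n : set (n.-tuple T) :=
  [set x | n%:R * e <= `|tuple_sum h x|].
Arguments A : clear implicits.

Let mA h e n : measurable_fun setT h -> measurable (A h e n).
Proof. exact: measurable_tuple_sum_tail. Qed.

Let fine_integral_indic n (E : set (n.-tuple T)) : measurable E ->
  (\int[power_measure P n]_x (\1_E x)%:E = (fine (power_measure P n E))%:E)%E.
Proof.
by move=> mE; rewrite integral_indic// setIT fineK// fin_num_measure.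
Qed.

Let mexp n l : measurable_fun setT
  (fun x : n.-tuple T => expR (tuple_sum (fun z => l * f z) x)).
Proof.
apply/measurableT_comp => //; apply: measurable_tuple_sum.
exact: (bounded_measurableZ l bf).1.
Qed.

(** Here [l] is the exponent called [k] in the overview. The positivity of the last integral makes
    Jensen's lower bound for the conditioning event nontrivial. *)
Theorem cond_prob_tilted_concentration (l e delta : R) :
  0 <= l -> 0 < e -> 0 < delta ->
  \int[P]_x (expR (l * f x) * f x) = 0 ->
  \int[P]_x (expR (l * f x) * u x) = 0 ->
  0 < \int[P]_x (expR (l * f x) * Num.max (f x) 0) ->
  let C n := [set x : n.-tuple T | 0 <= tuple_sum f x < n%:R * delta] in
  (\forall n \near \oo, 0 < fine (power_measure P n (C n))) /\
  cond_prob (power_measure P n) (A u e n) (C n) @[n --> \oo] --> 0.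
Proof.
move=> l0 e0 delta0 lf0 lu0 K0 C.
have bk := bounded_measurableZ l bf.
have [c c0 hc] := integral_power_measure_tail bk bu e0 lu0.
(* The first bound keeps [0 <= S < n * eta] inside [C n]; the second gives [l * eta < c], the [+ 1]
   covering the case [l = 0]. *)
pose eta := Num.min delta (c / (2 * l + 1)).
have l1 : 0 < 2 * l + 1 by rewrite ltr_wpDl// mulr_ge0.
have eta0 : 0 < eta by rewrite lt_min delta0 divr_gt0.
have etad : eta <= delta by rewrite ge_min lexx.
have leta : l * eta < c.
  have : eta <= c / (2 * l + 1) by rewrite ge_min lexx orbT.
  rewrite ler_pdivlMr//; have := mulr_ge0 l0 (ltW eta0); nra.
have [c' c'0 hc'] := integral_power_measure_tail bk bf eta0 lf0.
have mC n : measurable (C n).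
  rewrite (_ : C n = [set x : n.-tuple T | `[0, n%:R * delta[%classic (tuple_sum f x)]).
    exact: (measurable_tuple_sum_preimage bf.1).
  by apply/seteqP; split => x /=; rewrite in_itv.
have [M M0 fM] : exists2 M, 0 < M & forall x, `|f x| <= M.
  have [M fM] := bf.2; exists (`|M| + 1); first by rewrite ltr_wpDl.
  by move=> x; rewrite (le_trans (fM x))// (le_trans (ler_norm _))// lerDl.
set W := \int[P]_x expR (l * f x) in hc hc' *.
have W0 : 0 < W by exact: bounded_measurable_Rintegral_expR_gt0.
set K := \int[P]_x _ in K0.
have lsum n (x : n.-tuple T) : tuple_sum (fun z => l * f z) x = l * tuple_sum f x.
  by rewrite /tuple_sum mulr_sumr.
(* In [K / (W * M)], the factor [M] comes from [S <= n * M], and [W] compensates for [W ^+ n] in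
   Jensen's bound against [W ^+ n.+1] here. *)
apply: (@ratio_cvg0 R (fun n => fine (power_measure P n (A u e n `&` C n)))
  (fun n => fine (power_measure P n (C n))) W (K / (W * M)) (l * eta) c c') => //.
- by rewrite divr_gt0// mulr_gt0.
- move=> n; rewrite fine_ge0//= -lee_fin; apply: le_trans (hc n).
  rewrite -fine_integral_indic; last first.
    by apply: measurableI; [apply: mA; exact: bu.1|exact: mC].
  apply: ge0_le_integral => //.
  + apply/measurable_EFinP/measurable_indic/measurableI; last exact: mC.
    by apply: mA; exact: bu.1.
  + apply/measurable_EFinP/measurable_funM; first exact: mexp.
    by apply/measurable_indic; exact: (@mA u e n bu.1).
  move=> x _; rewrite lee_fin indicI/= mulrC ler_wpM2r//.
  rewrite indicE; case: (boolP (x \in C n)) => [|_]; last exact: expR_ge0.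
  rewrite inE => -[/andP[S0 _]]; rewrite -expR0 ler_expR lsum mulr_ge0//.
- move=> n; have hK := integral_power_measure_expR_max_ge bk bf lf0 n.
  set N : R := n.+1%:R; have N0 : 0 < N by rewrite ltr0n.
  have -> : K / (W * M) * W ^+ n.+1 = (W ^+ n * K) / M.
    by rewrite exprS; field; rewrite !gt_eqF.
  rewrite ler_pdivrMr// -lee_fin; apply: (le_trans hK).
  set L := expR (l * eta) ^+ n.+1.
  have L0 : 0 <= L by rewrite exprn_ge0 ?expR_ge0.
  have mCe : measurable_fun setT
      (fun x : n.+1.-tuple T => (L%:E * (\1_(C n.+1) x)%:E)%E).
    apply/measurable_EFinP/measurable_funM => //.
    by apply/measurable_indic; exact: mC.
  have mAe : measurable_fun setT (fun x : n.+1.-tuple T =>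
      (expR (tuple_sum (fun z => l * f z) x) * \1_(A f eta n.+1) x)%:E).
    apply/measurable_EFinP/measurable_funM; first exact: mexp.
    by apply/measurable_indic; exact: (@mA f eta n.+1 bf.1).
  have C0 (x : n.+1.-tuple T) : (0 <= L%:E * (\1_(C n.+1) x)%:E)%E.
    by rewrite -EFinM lee_fin mulr_ge0.
  have A0 (x : n.+1.-tuple T) :
      (0 <= (expR (tuple_sum (fun z => l * f z) x) * \1_(A f eta n.+1) x)%:E)%E.
    by rewrite lee_fin mulr_ge0 ?expR_ge0.
  (* Pointwise bound of the integrand: it is zero if [S <= 0]; if [0 < S < N * eta], the point is in
     [C n.+1] and the exponential is at most [L]; otherwise the point is in the tail set
     [A f eta n.+1]. In the last two cases [S <= N * M]. *)
  apply: (@le_trans _ _ (\int[power_measure P n.+1]_x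
    ((N * M)%:E * (L%:E * (\1_(C n.+1) x)%:E +
     (expR (tuple_sum (fun z => l * f z) x) * \1_(A f eta n.+1) x)%:E)))%E).
    apply: ge0_le_integral => //.
    + by move=> x _; rewrite lee_fin mulr_ge0 ?expR_ge0// le_max lexx orbT.
    + apply/measurable_EFinP/measurable_funM; first exact: mexp.
      by apply: measurable_maxr => //; exact: measurable_tuple_sum bf.1.
    + by apply: measurable_funeM; exact: emeasurable_funD.
    move=> x _; rewrite -[leRHS]/((N * M * (L * \1_(C n.+1) x +
      expR (tuple_sum (fun z => l * f z) x) * \1_(A f eta n.+1) x))%:E).
    rewrite lee_fin lsum.
    have [S0|S0] := leP (tuple_sum f x) 0.
      have NM0 : 0 <= N * M by rewrite mulr_ge0// ltW.
      rewrite mulr0; apply: (mulr_ge0 NM0).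
      by rewrite addr_ge0// mulr_ge0// expR_ge0.
    have SM : tuple_sum f x <= N * M.
      by rewrite (le_trans (ler_norm _))// norm_tuple_sum.
    rewrite mulrC ler_pM ?expR_ge0 ?(ltW S0)//.
    have [S1|S1] := ltP (tuple_sum f x) (N * eta).
      rewrite [\1_(C n.+1) x]indicE mem_set; last first.
        by rewrite /C/= (ltW S0)/= (lt_le_trans S1)// ler_wpM2l// ltW.
      rewrite mulr1 -[leLHS]addr0 lerD ?mulr_ge0 ?expR_ge0//.
      by rewrite /L -expRM_natr ler_expR -mulrA ler_wpM2l// mulrC ltW.
    rewrite [\1_(A f eta n.+1) x]indicE mem_set; last first.
      by rewrite /A/= (le_trans S1)// ler_norm.
    by rewrite mulr1 -[leLHS]add0r lerD// mulr_ge0.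
  rewrite ge0_integral_power_measureZ//; last 3 first.
  + exact: emeasurable_funD.
  + by move=> x; rewrite adde_ge0.
  + by rewrite mulr_ge0 ?ltW.
  rewrite ge0_integralD// ge0_integral_power_measureZ//; last first.
    by apply/measurable_EFinP/measurable_indic; exact: mC.
  rewrite fine_integral_indic; last exact: mC.
  rewrite mulrAC [leRHS]EFinM lee_pmul2l ?lte_fin ?mulr_gt0//.
  by rewrite EFinD EFinM leeD2l//; exact: hc'.
Qed.

End concentration.

(** * Canonical measures *)

Section canonical.
Context d (T : measurableType d) (R : realType).
Variables (mu : probability T R) (g : {mfun T >-> R}).
Hypothesis g_bounded : exists M : R, forall x, `|g x| <= M.

Let bg : bounded_measurable g. Proof. by split. Qed.

Lemma partition_function_gt0 l : 0 < partition_function mu g l.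
Proof. exact/bounded_measurable_Rintegral_expR_gt0/bounded_measurableZ. Qed.

Lemma bounded_measurable_density l :
  bounded_measurable (fun x => expR (l * g x) / partition_function mu g l).
Proof.
apply: bounded_measurableM; last exact: bounded_measurable_cst.
exact/bounded_measurable_expR/bounded_measurableZ.
Qed.

(** Change of variables with the Radon-Nikodym derivative, once this is identified almost everywhere
    with the explicit density. *)
Lemma Rintegral_canonical_measure l (h : T -> R) : bounded_measurable h ->
  \int[canonical_measure mu g l]_x h x =
  (\int[mu]_x (expR (l * g x) * h x)) / partition_function mu g l.
Proof.
move=> bh.
pose nu : probability T R := HB.pack (canonical_measure mu g l)
  (Measure_isProbability.Build _ _ _ (canonical_measure mu g l)
     (canonical_measure_setT mu l g_bounded)).
have nuE A : nu A =
  (\int[mu]_(x in A) (expR (l * g x) / partition_function mu g l)%:E)%E by [].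
have numu : nu `<< mu.
  apply/null_content_dominatesP => A mA A0.
  by rewrite nuE null_set_integral//; apply/measurable_funTS/measurable_EFinP;
    exact: (bounded_measurable_density l).1.
have bw := bounded_measurable_density l.
have mRN : measurable_fun setT (Radon_Nikodym (charge_of_finite_measure nu) mu) by [].
have := @Radon_Nikodym_change_of_variables _ _ _ nu mu numu (EFin \o h) setT
  measurableT (bounded_measurable_integrable nu bh).
rewrite /Rintegral => hE.
transitivity (fine (\int[nu]_x (h x)%:E)%E); first by [].
rewrite -[X in fine X]hE.
transitivity (\int[mu]_x (expR (l * g x) * h x / partition_function mu g l)).
  congr fine; apply: ae_eq_integral => //; last 3 first.
  - by apply: emeasurable_funM => //; apply/measurable_EFinP; exact: bh.1.
  - apply/measurable_EFinP/measurable_funM => //.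
    apply/measurable_funM; last exact: bh.1.
    exact: (bounded_measurable_expR (bounded_measurableZ l bg)).1.
  (* Both functions have integral [nu E] over every measurable [E]. *)
  have : ae_eq mu setT (Radon_Nikodym (charge_of_finite_measure nu) mu)
      (fun x => (expR (l * g x) / partition_function mu g l)%:E).
    apply: integral_ae_eq => //.
    - exact: Radon_Nikodym_integrable.
    - by apply/measurable_EFinP; exact: bw.1.
    - by move=> E _ mE; rewrite -nuE -Radon_Nikodym_integral.
  apply: filterS => x /(_ I) hx _; rewrite /= hx// -EFinM; congr (_%:E).
  by rewrite mulrA [h x * _]mulrC.
under eq_Rintegral do rewrite mulrC.
rewrite bounded_measurable_RintegralZ; first by rewrite mulrC.
apply: (bounded_measurableM _ bh).
exact/bounded_measurable_expR/bounded_measurableZ.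
Qed.

End canonical.

(** * Concentration without tilting *)

Section centered.
Context d (T : measurableType d) (R : realType) (P : probability T R).

(** By Chernoff's bound with [k = 0], the probability of [C n] tends to 1 and that of the deviation
    to 0, so that conditioning does not matter in the limit. *)
Theorem cond_prob_centered_concentration (f u : T -> R) (e delta : R) :
  bounded_measurable f -> bounded_measurable u -> 0 < e -> 0 < delta ->
  \int[P]_x f x = 0 -> \int[P]_x u x = 0 ->
  let C n := [set x : n.-tuple T | `|tuple_sum f x| < n%:R * delta] in
  (\forall n \near \oo, 0 < fine (power_measure P n (C n))) /\
  cond_prob (power_measure P n)
    [set x | n%:R * e <= `|tuple_sum u x|] (C n) @[n --> \oo] --> 0.
Proof.
move=> bf bu e0 delta0 f0 u0 C.
have tail h b : bounded_measurable h -> 0 < b -> \int[P]_x h x = 0 ->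
    fine (power_measure P n [set x | n%:R * b <= `|tuple_sum h x|])
      @[n --> \oo] --> 0.
  move=> bh b0 h0.
  have eh0 : \int[P]_x (expR (cst 0 x) * h x) = 0.
    by under eq_Rintegral do rewrite expR0 mul1r.
  have W1 : \int[P]_x expR (cst 0 x) = 1.
    rewrite -[RHS](Rintegral_probability_cst P 1).
    by apply: eq_Rintegral => x _; exact: expR0.
  have sum0 n (x : n.-tuple T) : tuple_sum (cst 0 : T -> R) x = 0.
    by rewrite /tuple_sum big1.
  have [c c0 hc] :=
    integral_power_measure_tail (bounded_measurable_cst T (0 : R)) bh b0 eh0.
  apply: (@squeeze_cvgr _ _ _ _ (cst 0) (fun n => 2 * expR (- c) ^+ n)).
  - near=> n; rewrite fine_ge0//= -lee_fin fineK ?fin_num_measure//; last first.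
      exact: measurable_tuple_sum_tail bh.1.
    move: (hc n); rewrite W1 mul1r.
    under eq_integral do rewrite sum0 expR0 mul1r.
    by rewrite integral_indic ?setIT//; exact: measurable_tuple_sum_tail bh.1.
  - exact: cvg_cst.
  - rewrite -[X in _ --> X](mulr0 2); apply: cvgMr; apply: cvg_expr.
    by rewrite ger0_norm ?expR_ge0// expR_lt1 oppr_lt0.
have CE n : C n = ~` [set x | n%:R * delta <= `|tuple_sum f x|].
  by apply/seteqP; split=> x; rewrite /C/= ltNge => /negP.
have mC n : measurable (C n).
  by rewrite CE; apply: measurableC; exact: measurable_tuple_sum_tail bf.1.
have C1 : fine (power_measure P n (C n)) @[n --> \oo] --> (1 : R).
  rewrite -[X in _ --> X]subr0.
  rewrite (_ : (fun _ => _) = (fun n => 1 -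
      fine (power_measure P n [set x | n%:R * delta <= `|tuple_sum f x|]))).
    by apply: cvgB; [exact: cvg_cst|exact: tail].
  apply/funext => n; have mT := @measurable_tuple_sum_tail _ _ _ n f delta bf.1.
  by rewrite CE probability_setC// fineB// fin_num_measure.
split.
  by have /(cvgr_gt 1)/(_ _ ltr01) := C1.
apply: (@squeeze_cvgr _ _ _ _ (cst 0)
  (fun n => fine (power_measure P n [set x | n%:R * e <= `|tuple_sum u x|]) /
            fine (power_measure P n (C n)))).
- near=> n; rewrite /cond_prob divr_ge0 ?fine_ge0//=.
  have mT := @measurable_tuple_sum_tail _ _ _ n u e bu.1.
  rewrite ler_wpM2r ?invr_ge0 ?fine_ge0// fine_le ?fin_num_measure//.
    exact: (measurableI _ _ mT (mC n)).
  by rewrite le_measure ?inE//; exact: (measurableI _ _ mT (mC n)).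
- exact: cvg_cst.
- rewrite -[X in _ --> X](divr1 0); apply: cvgM; first exact: tail.
  by apply: cvgV => //; rewrite oner_eq0.
Unshelve. all: by end_near. Qed.

End centered.

(** * Conditional concentration at the canonical parameter *)

Section canonical_concentration.
Context d (T : measurableType d) (R : realType).
Variables (mu : probability T R) (g : {mfun T >-> R}).
Hypothesis g_bounded : exists M : R, forall x, `|g x| <= M.

Let bg : bounded_measurable g. Proof. by split. Qed.

Let beg l : bounded_measurable (fun x => expR (l * g x)).
Proof. exact/bounded_measurable_expR/bounded_measurableZ. Qed.

(** Puts the constraint into the unnormalised form under [mu] that the tilted estimates take as
    hypothesis. *)
Lemma Rintegral_canonical_centered l (h : T -> R) a : bounded_measurable h ->
  \int[canonical_measure mu g l]_x h x = a ->
  \int[mu]_x (expR (l * g x) * (h x - a)) = 0.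
Proof.
move=> bh; rewrite Rintegral_canonical_measure// => ha.
have Z0 := partition_function_gt0 mu g_bounded l.
have -> : \int[mu]_x (expR (l * g x) * (h x - a)) =
    \int[mu]_x (expR (l * g x) * h x + (- a) * expR (l * g x)).
  by apply: eq_Rintegral => x _; rewrite mulrBr mulNr [a * _]mulrC.
rewrite bounded_measurable_RintegralD; last 2 first.
- exact: bounded_measurableM.
- exact: bounded_measurableZ.
rewrite bounded_measurable_RintegralZ// -/(partition_function mu g l).
by rewrite -ha mulNr divfK ?subrr// gt_eqF.
Qed.

Section at_parameter.
Variables (l y : R).
Hypothesis ly : \int[canonical_measure mu g l]_x g x = y.

Let gy0 : \int[mu]_x (expR (l * g x) * (g x - y)) = 0.
Proof. exact: Rintegral_canonical_centered. Qed.

Let bgy : bounded_measurable (fun x => g x - y).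
Proof. by apply: bounded_measurableD => //; exact: bounded_measurable_cst. Qed.

Let ystarE : \int[mu]_x (g x - y) = ystar mu g - y.
Proof.
rewrite bounded_measurable_RintegralD//; last exact: bounded_measurable_cst.
by rewrite (Rintegral_probability_cst mu (- y)).
Qed.

(* [exp (l g) - exp (l y)] and [l (g - y)] have the same sign. *)
Let F x := l * ((g x - y) * (expR (l * g x) - expR (l * y))).

Let F_ge0 x : 0 <= F x.
Proof.
rewrite /F mulrA [l * (_ - _)]mulrBr.
have [h|h] := leP (l * y) (l * g x).
  by rewrite mulr_ge0 ?subr_ge0 ?ler_expR.
by rewrite mulr_le0// ?subr_le0 ?ler_expR ltW.
Qed.

Let bF : bounded_measurable F.
Proof.
apply/bounded_measurableZ/bounded_measurableM => //.
by apply: bounded_measurableD => //; exact: bounded_measurable_cst.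
Qed.

Let F_int : \int[mu]_x F x = l * (y - ystar mu g) * expR (l * y).
Proof.
rewrite bounded_measurable_RintegralZ; last first.
  apply: bounded_measurableM => //.
  by apply: bounded_measurableD => //; exact: bounded_measurable_cst.
have -> : \int[mu]_x ((g x - y) * (expR (l * g x) - expR (l * y))) =
    \int[mu]_x (expR (l * g x) * (g x - y) + (- expR (l * y)) * (g x - y)).
  by apply: eq_Rintegral => x _; ring.
rewrite bounded_measurable_RintegralD; last 2 first.
- exact: bounded_measurableM.
- exact: bounded_measurableZ.
rewrite bounded_measurable_RintegralZ// ystarE gy0; ring.
Qed.

(** Up to a positive factor this is the integral of [F >= 0]. It makes the tilting exponent [sg * l]
    nonnegative. *)
Lemma canonical_parameter_sign : 0 <= l * (y - ystar mu g).
Proof.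
rewrite -(@pmulr_lge0 _ (expR (l * y))) ?expR_gt0// -F_int.
by apply: Rintegral_ge0 => x _.
Qed.

(** Here [F >= 0] has integral zero, hence vanishes almost everywhere. Then [expR (l * g x)] is
    almost everywhere constant and cancels against the partition function. *)
Lemma Rintegral_canonical_ystar (h : T -> R) : bounded_measurable h ->
  y = ystar mu g -> \int[canonical_measure mu g l]_x h x = \int[mu]_x h x.
Proof.
move=> bh yE.
have F0 : ae_eq mu setT (EFin \o F) (cst 0%E).
  apply/(ae_eq_integral_abs mu measurableT).
    by apply/measurable_EFinP; exact: bF.1.
  under eq_integral do rewrite /= ger0_norm//.
  by rewrite bounded_measurable_EFin_Rintegral// F_int yE subrr mulr0 mul0r.
have gE : {ae mu, forall x, expR (l * g x) = expR (l * y)}.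
  apply: filterS F0 => x /(_ I) -[] /eqP.
  rewrite /F !mulf_eq0 !subr_eq0 => /or3P[/eqP->|/eqP->|/eqP->] //.
  by rewrite !mul0r.
have eqh (k : T -> R) : bounded_measurable k ->
    \int[mu]_x (expR (l * g x) * k x) = expR (l * y) * \int[mu]_x k x.
  move=> bk; rewrite -bounded_measurable_RintegralZ//.
  congr fine; apply: ae_eq_integral => //.
  - by apply/measurable_EFinP; exact: (bounded_measurableM (beg l) bk).1.
  - by apply/measurable_EFinP; exact: (bounded_measurableZ _ bk).1.
  - by apply: filterS gE => x -> _.
rewrite Rintegral_canonical_measure// eqh//.
have -> : partition_function mu g l = expR (l * y).
  rewrite -[RHS]mulr1 -[X in _ * X](Rintegral_probability_cst mu 1).
  rewrite -eqh; last exact: bounded_measurable_cst.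
  by apply: eq_Rintegral => x _; rewrite mulr1.
by rewrite mulrAC divff ?mul1r// gt_eqF ?expR_gt0.
Qed.

(** If the integral were zero, then, as [f] is centered for the tilted weight and its absolute value
    is twice its positive part minus [f], that absolute value would integrate to zero too, forcing
    [y = ystar]. *)
Lemma Rintegral_expR_max_gt0 (sg : R) : `|sg| = 1 -> y != ystar mu g ->
  0 < \int[mu]_x (expR (l * g x) * Num.max (sg * (g x - y)) 0).
Proof.
move=> sg1 yy; pose f x := sg * (g x - y).
have bf : bounded_measurable f by exact: bounded_measurableZ.
have bm := bounded_measurable_max0 bf.
rewrite lt_neqAle; apply/andP; split; last first.
  by apply: Rintegral_ge0 => x _; rewrite mulr_ge0 ?expR_ge0// le_max lexx orbT.
apply/negP => /eqP K0.
have [M gM] := g_bounded.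
(* The weight is bounded away from zero, so a vanishing weighted integral of a nonnegative function
   vanishes under [mu] as well. *)
have egM x : 1 <= expR (`|l| * M) * expR (l * g x).
  rewrite -expRD -expR0 ler_expR -lerBlDr sub0r.
  have : `|l * g x| <= `|l| * M by rewrite normrM ler_wpM2l.
  by move=> h; rewrite (le_trans _ h)// -normrN ler_norm.
have normf x : `|f x| = 2 * Num.max (f x) 0 - f x.
  by case: (ltrP (f x) 0) => h; [rewrite ltr0_norm//|rewrite ger0_norm//]; ring.
have bnf : bounded_measurable (fun x => `|f x|).
  split; first exact: measurableT_comp bf.1.
  by have [N fN] := bf.2; exists N => x; rewrite normr_id.
have I0 : \int[mu]_x (expR (l * g x) * `|f x|) = 0.
  have -> : \int[mu]_x (expR (l * g x) * `|f x|) = \int[mu]_x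
      (2 * (expR (l * g x) * Num.max (f x) 0) +
       (- sg) * (expR (l * g x) * (g x - y))).
    by apply: eq_Rintegral => x _; rewrite normf /f; ring.
  rewrite bounded_measurable_RintegralD; last 2 first.
  - exact/bounded_measurableZ/bounded_measurableM.
  - exact/bounded_measurableZ/bounded_measurableM.
  rewrite !bounded_measurable_RintegralZ; try exact: bounded_measurableM.
  by rewrite gy0 -K0 !mulr0 addr0.
have J0 : \int[mu]_x `|f x| <= 0.
  rewrite -(mulr0 (expR (`|l| * M))) -I0.
  rewrite -bounded_measurable_RintegralZ; last exact: bounded_measurableM.
  apply: bounded_measurable_le_Rintegral => //.
    exact/bounded_measurableZ/bounded_measurableM.
  by move=> x; rewrite mulrA ler_peMl.
have : `|\int[mu]_x f x| <= 0.
  apply: le_trans J0; apply: le_normr_Rintegral => //.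
  exact: bounded_measurable_integrable.
rewrite bounded_measurable_RintegralZ// ystarE normrM sg1 mul1r normr_le0.
by rewrite subr_eq0 eq_sym (negbTE yy).
Qed.

End at_parameter.

(** The tilted theorem for [f = sg * (g - y)] and exponent [sg * l]; the sign [sg] treats both sides
    of [ystar] at once. *)
Lemma cond_prob_sided_concentration l y (sg e delta : R) (u : T -> R) :
  \int[canonical_measure mu g l]_x g x = y ->
  `|sg| = 1 -> 0 < sg * (y - ystar mu g) ->
  bounded_measurable u -> \int[mu]_x (expR (l * g x) * u x) = 0 ->
  0 < e -> 0 < delta ->
  let C n := [set x : n.-tuple T |
    0 <= tuple_sum (fun z => sg * (g z - y)) x < n%:R * delta] in
  (\forall n \near \oo, 0 < fine (power_measure mu n (C n))) /\
  cond_prob (power_measure mu n)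
    [set x | n%:R * e <= `|tuple_sum u x|] (C n) @[n --> \oo] --> 0.
Proof.
move=> ly sg1 sgy bu u0 e0 delta0.
have sg2 : sg * sg = 1.
  by rewrite -expr2 -real_normK ?num_real// sg1 expr1n.
have yy : y != ystar mu g.
  by apply: contraTneq sgy => ->; rewrite subrr mulr0 ltxx.
have bf : bounded_measurable (fun z => sg * (g z - y)).
  by apply/bounded_measurableZ/bounded_measurableD => //;
    exact: bounded_measurable_cst.
(* As [sg * sg = 1], the exponent is [l * g x - l * y]: the weight is that of the canonical measure
   up to a constant. *)
have tilt (k : T -> R) : bounded_measurable k ->
    \int[mu]_x (expR ((sg * l) * (sg * (g x - y))) * k x) =
    expR (- (l * y)) * \int[mu]_x (expR (l * g x) * k x).
  move=> bk; rewrite -bounded_measurable_RintegralZ; last first.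
    exact: bounded_measurableM.
  apply: eq_Rintegral => x _; rewrite [RHS]mulrA -expRD; congr (expR _ * _).
  have -> : sg * l * (sg * (g x - y)) = (sg * sg) * (l * (g x - y)) by ring.
  by rewrite sg2; ring.
apply: (@cond_prob_tilted_concentration _ _ _ mu _ _ bf bu (sg * l)) => //.
- rewrite -(@pmulr_lge0 _ (sg * (y - ystar mu g)))//.
  have -> : sg * l * (sg * (y - ystar mu g)) = (sg * sg) * (l * (y - ystar mu g)).
    by ring.
  by rewrite sg2 mul1r canonical_parameter_sign.
- rewrite tilt//.
  have -> : \int[mu]_x (expR (l * g x) * (sg * (g x - y))) =
      \int[mu]_x (sg * (expR (l * g x) * (g x - y))).
    by apply: eq_Rintegral => x _; rewrite mulrCA.
  rewrite bounded_measurable_RintegralZ; last first.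
    by apply/bounded_measurableM/bounded_measurableD => //;
      exact: bounded_measurable_cst.
  by rewrite Rintegral_canonical_centered// !mulr0.
- by rewrite tilt// u0 mulr0.
- rewrite tilt; last exact: bounded_measurable_max0.
  by rewrite mulr_gt0 ?expR_gt0//; exact: Rintegral_expR_max_gt0.
Qed.

Lemma tuple_sumB_empirical_mean (h : T -> R) c n (x : n.+1.-tuple T) :
  tuple_sum (fun z => h z - c) x = n.+1%:R * (empirical_mean h x - c).
Proof.
rewrite /tuple_sum sumrB sumr_const card_ord mulrBr.
by rewrite /empirical_mean mulrCA divff ?pnatr_eq0// mulr1 mulr_natl.
Qed.

Theorem cond_prob_canonical_concentration (h : T -> R) (y e delta : R) :
  bounded_measurable h -> (exists l : R, theta mu g l%:E = y) ->
  0 < e -> 0 < delta ->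
  let a := \int[canonical_measure mu g (theta_inv mu g y)]_x h x in
  let C n := [set x : n.-tuple T |
    Bdelta mu g y delta (empirical_mean g x)] in
  (\forall n \near \oo, 0 < fine (power_measure mu n (C n))) /\
  cond_prob (power_measure mu n)
    [set x | n%:R * e <= `|tuple_sum (fun z => h z - a) x|] (C n)
    @[n --> \oo] --> 0.
Proof.
move=> bh yl e0 delta0 a C.
set l := theta_inv mu g y in a *.
have ly : \int[canonical_measure mu g l]_x g x = y by exact: (getPex yl).
have bu : bounded_measurable (fun z => h z - a).
  by apply: bounded_measurableD => //; exact: bounded_measurable_cst.
have u0 : \int[mu]_x (expR (l * g x) * (h x - a)) = 0.
  exact: Rintegral_canonical_centered.
(* For [n = 0] the empirical mean is a division by zero, so the two forms of the event are compared
   for positive [n] only, which suffices for limits. *)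
have transfer (C' : forall n, set (n.-tuple T)) :
    (forall n, C n.+1 = C' n.+1) ->
    (\forall n \near \oo, 0 < fine (power_measure mu n (C' n))) /\
    cond_prob (power_measure mu n)
      [set x | n%:R * e <= `|tuple_sum (fun z => h z - a) x|] (C' n)
      @[n --> \oo] --> 0 ->
    (\forall n \near \oo, 0 < fine (power_measure mu n (C n))) /\
    cond_prob (power_measure mu n)
      [set x | n%:R * e <= `|tuple_sum (fun z => h z - a) x|] (C n)
      @[n --> \oo] --> 0.
  move=> CC' [pos lim]; split; last first.
    rewrite -cvg_shiftS/=; under eq_fun do rewrite CC'.
    by rewrite -cvg_shiftS in lim.
  have CE n : (0 < n)%N -> C n = C' n by case: n.
  near=> n; rewrite CE; last by near: n; exact: nbhs_infty_gt.
  by near: n.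
have sided (sg : R) : `|sg| = 1 -> 0 < sg * (y - ystar mu g) ->
    (forall r, Bdelta mu g y delta r <-> 0 <= sg * (r - y) < delta) ->
    (\forall n \near \oo, 0 < fine (power_measure mu n (C n))) /\
    cond_prob (power_measure mu n)
      [set x | n%:R * e <= `|tuple_sum (fun z => h z - a) x|] (C n)
      @[n --> \oo] --> 0.
  move=> sg1 sgy Bsg.
  apply: transfer (cond_prob_sided_concentration ly sg1 sgy bu u0 e0 delta0).
  move=> n; apply/seteqP; rewrite /C.
  have sumE (x : n.+1.-tuple T) : tuple_sum (fun z => sg * (g z - y)) x =
      n.+1%:R * (sg * (empirical_mean g x - y)).
    rewrite mulrCA -tuple_sumB_empirical_mean /tuple_sum.
    by rewrite mulr_sumr.
  by split=> x /=; rewrite sumE ltr_pM2l ?ltr0n// pmulr_rge0 ?ltr0n// => /Bsg.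
have [yy|yy|yy] := ltgtP y (ystar mu g).
- apply: (sided (-1)); rewrite ?normrN ?normr1// ?mulN1r ?opprB ?subr_gt0//.
  move=> r; rewrite /Bdelta yy/= in_itv/= mulN1r opprB subr_ge0.
  by rewrite ltrBlDr addrC -ltrBlDr andbC.
- apply: (sided 1); rewrite ?normr1// ?mul1r ?subr_gt0//.
  move=> r; rewrite /Bdelta ltNge (ltW yy)/= yy/= in_itv/= mul1r subr_ge0.
  by rewrite ltrBlDl.
have gy0 : \int[mu]_x (g x - y) = 0.
  rewrite bounded_measurable_RintegralD//; last exact: bounded_measurable_cst.
  by rewrite (Rintegral_probability_cst mu (- y)) -/(ystar mu g) yy subrr.
(* At [y = ystar] the canonical measure gives [h] the same mean as [mu]. *)
have u0' : \int[mu]_x (h x - a) = 0.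
  rewrite bounded_measurable_RintegralD//; last exact: bounded_measurable_cst.
  rewrite (Rintegral_probability_cst mu (- a)).
  by rewrite /a (Rintegral_canonical_ystar ly bh yy) subrr.
have bgy : bounded_measurable (fun z => g z - y).
  by apply: bounded_measurableD => //; exact: bounded_measurable_cst.
apply: transfer (cond_prob_centered_concentration bgy bu e0 delta0 gy0 u0').
move=> n; apply/seteqP; rewrite /C /Bdelta yy ltxx.
by split=> x /=; rewrite tuple_sumB_empirical_mean normrM ger0_norm//
  ltr_pM2l ?ltr0n// ltr_distl in_itv.
Unshelve. all: by end_near. Qed.

End canonical_concentration.

(** * Conditional probabilities, bounds on means, and the limit theorem *)

Lemma cond_prob_le d (T : measurableType d) (R : realType)
  (P : probability T R) (A B C : set T) :
  measurable A -> measurable B -> measurable C -> A `<=` B ->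
  cond_prob P A C <= cond_prob P B C.
Proof.
move=> mA mB mC AB; rewrite /cond_prob ler_wpM2r ?invr_ge0 ?fine_ge0//.
rewrite fine_le ?fin_num_measure//; try exact: measurableI.
by rewrite le_measure ?inE//; [exact: measurableI|exact: measurableI|exact: setSI].
Qed.

Lemma cond_prob_ge0 d (T : measurableType d) (R : realType)
  (P : probability T R) (A C : set T) : 0 <= cond_prob P A C.
Proof. by rewrite /cond_prob divr_ge0 ?fine_ge0. Qed.

Lemma cond_probC d (T : measurableType d) (R : realType)
  (P : probability T R) (A C : set T) :
  measurable A -> measurable C -> 0 < fine (P C) ->
  cond_prob P A C = 1 - cond_prob P (~` A) C.
Proof.
move=> mA mC C0; apply/eqP; rewrite eq_sym subr_eq; apply/eqP.
have mAC := measurableI _ _ mA mC.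
have mCAC := measurableI _ _ (measurableC mA) mC.
rewrite /cond_prob -mulrDl -fineD ?fin_num_measure//.
rewrite -measureU//; last by rewrite setIACA setICr set0I.
by rewrite -setIUl setUv setTI divff// gt_eqF.
Qed.

Section canonical_bounds.
Context d (T : measurableType d) (R : realType).
Variables (mu : probability T R) (g : {mfun T >-> R}).
Hypothesis g_bounded : exists M : R, forall x, `|g x| <= M.

Lemma Rintegral_canonical_measure_itv l (h : T -> R) (a b : R) :
  measurable_fun setT h -> (forall x, a <= h x <= b) ->
  a <= \int[canonical_measure mu g l]_x h x <= b.
Proof.
move=> mh hab.
have bh : bounded_measurable h.
  split=> //; exists (Num.max `|a| `|b|) => x; have /andP[ax xb] := hab x.
  rewrite ler_norml lerNl !le_max; apply/andP; split; apply/orP.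
    by left; apply: (@le_trans _ _ (- a)); rewrite ?lerN2// -normrN ler_norm.
  by right; rewrite (le_trans xb)// ler_norm.
have be : bounded_measurable (fun x => expR (l * g x)).
  by apply/bounded_measurable_expR/bounded_measurableZ; split.
have Z0 := partition_function_gt0 mu g_bounded l.
rewrite Rintegral_canonical_measure// ler_pdivlMr// ler_pdivrMr//.
rewrite -!bounded_measurable_RintegralZ//.
apply/andP; split; apply: bounded_measurable_le_Rintegral;
  rewrite ?[_ * expR _]mulrC; try exact: bounded_measurableZ;
  try exact: bounded_measurableM; move=> x; have /andP[ax xb] := hab x;
  by rewrite [_ * expR _]mulrC ler_wpM2l ?expR_ge0.
Qed.

End canonical_bounds.

Section empirical_mean.
Context d (T : measurableType d) (R : realType).
Implicit Type h : T -> R.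

Lemma measurable_empirical_mean_preimage h n (D : set R) :
  measurable_fun setT h -> measurable D ->
  measurable [set x : n.-tuple T | D (empirical_mean h x)].
Proof.
move=> mh mD; rewrite -[X in measurable X]setTI.
have mE : measurable_fun setT (fun x : n.-tuple T => empirical_mean h x).
  by apply: measurable_funM => //; exact: measurable_tuple_sum.
exact: mE.
Qed.

Lemma empirical_mean_itv h (a b : R) n (x : n.+1.-tuple T) :
  (forall z, a <= h z <= b) -> a <= empirical_mean h x <= b.
Proof.
move=> hab; apply/andP; split.
  rewrite -subr_ge0 -(@pmulr_rge0 _ n.+1%:R) ?ltr0n//.
  rewrite -tuple_sumB_empirical_mean; apply: sumr_ge0 => i _.
  by rewrite subr_ge0; have /andP[] := hab (tnth x i).
rewrite -subr_le0 -(@pmulr_rle0 _ n.+1%:R) ?ltr0n//.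
rewrite -tuple_sumB_empirical_mean; apply: sumr_le0 => i _.
by rewrite subr_le0; have /andP[] := hab (tnth x i).
Qed.

End empirical_mean.

Lemma measurable_Bdelta d (T : measurableType d) (R : realType)
  (mu : probability T R) (g : {mfun T >-> R}) (y delta : R) :
  measurable (Bdelta mu g y delta).
Proof. by rewrite /Bdelta; case: ifP => _ //; case: ifP. Qed.

(** The assumption [Y a] matters: at points outside [Y] the neighbourhoods of [subspace Y] are not
    traces of balls. *)
Lemma nbhs_subspace_ball (R : realType) (Y V : set R) (a : R) : Y a ->
  nbhs (a : subspace Y) V ->
  exists2 e : R, 0 < e & forall r, `|r - a| < e -> Y r -> V r.
Proof.
move=> Ya; rewrite -[nbhs _ V]/(nbhs_subspace (a : subspace Y) V).
rewrite -nbhs_subspace_in// => /nbhs_ballP[e /= e0 eV]; exists e => // r ra Yr.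
by apply: eV => //; rewrite /ball/= distrC.
Qed.

(** The topology of [Y] provides a radius [e] such that the points of [Y] closer than [e] to [psi]
    all lie outside [B], or all inside. Concentration of the empirical mean of [g \o phi t] at that
    radius then gives the limit. *)
Theorem mainTheorem1 (R : realType) (X : completeMetricType R)
  (X_separable : separable X)
  (mu : probability (borelType X) R)
  (g : {mfun borelType X >-> R})
  (g_bounded : exists M : R, forall x, `|g x| <= M)
  (g_cont : {ae mu, forall x : X, {for x, continuous (g : X -> R)}})
  (T : set R) (T0 : T 0)
  (phi : R -> X -> X)
  (phi_meas : forall t, T t ->
     measurable_fun setT (phi t : borelType X -> borelType X))
  (phi_cont : forall t, T t ->
     {ae mu, forall x : X, {for x, continuous (phi t)}})
  (phi_id : phi 0 = id)
  (y : R) (y_in : ymin g < y < ymax g)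
  (y_attained : exists l : R, theta mu g l%:E = y)
  (delta : R) (delta_gt0 : 0 < delta)
  (t : R) (Tt : T t)
  (B : set R) (B_meas : measurable B) (BY : B `<=` `[ymin g, ymax g]%classic) :
  (* closure and interior of B are taken in the space Y *)
  let Y : set R := `[ymin g, ymax g]%classic in
  let B_Y : set (subspace Y) := B in
  let p (n : nat) : R := cond_prob (power_measure mu n)
    [set x | B (empirical_mean (g \o phi t) x)]
    [set x | Bdelta mu g y delta (empirical_mean g x)] in
  (~ closure B_Y (psi mu g (phi t) y) -> p n @[n --> \oo] --> (0 : R)) /\
  (interior B_Y (psi mu g (phi t) y) -> p n @[n --> \oo] --> (1 : R)).
Proof.
move=> Y B_Y p.
set h : borelType X -> R := g \o phi t in p *.
set a := psi mu g (phi t) y.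
have mh : measurable_fun setT h.
  by apply: measurableT_comp => //; exact: phi_meas.
have bh : bounded_measurable h.
  by split => //; have [M gM] := g_bounded; exists M => x; exact: gM.
have hY x : ymin g <= h x <= ymax g.
  have [M gM] := g_bounded; apply/andP; split.
    apply: ge_inf; last by exists (phi t x).
    by exists (- M) => _ [z _ <-]; have := gM z; rewrite ler_norml => /andP[].
  apply: ub_le_sup; last by exists (phi t x).
  by exists M => _ [z _ <-]; have := gM z; rewrite ler_norml => /andP[].
have Ya : Y a by rewrite /Y/= in_itv/=; exact: Rintegral_canonical_measure_itv.
pose C n := [set x : n.-tuple (borelType X) |
  Bdelta mu g y delta (empirical_mean g x)].
have mC n : measurable (C n).
  apply: measurable_empirical_mean_preimage => //.
  exact: measurable_Bdelta.
have mB n : measurable [set x : n.-tuple (borelType X) | B (empirical_mean h x)].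
  exact: measurable_empirical_mean_preimage.
pose A e n := [set x : n.-tuple (borelType X) |
  n%:R * e <= `|tuple_sum (fun z => h z - a) x|].
have AE e n (x : n.+1.-tuple (borelType X)) :
    A e n.+1 x = (e <= `|empirical_mean h x - a|).
  rewrite /A/= tuple_sumB_empirical_mean normrM ger0_norm//.
  by rewrite ler_pM2l// ltr0n.
have mA e n : measurable (A e n).
  by apply: measurable_tuple_sum_tail; apply: measurable_funB.
have conc e := cond_prob_canonical_concentration g_bounded bh y_attained
  (e := e) ^~ delta_gt0.
split=> [|/(nbhs_subspace_ball Ya)[e e0 eB]].
  (* Outside the closure, some neighbourhood [V] of [psi] misses [B]. *)
  move=> /existsNP[V] /not_implyP[/(nbhs_subspace_ball Ya)[e e0 eV] BV0].
  have [_ lim] := conc e e0.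
  have BA n : (0 < n)%N -> [set x : n.-tuple (borelType X) |
      B (empirical_mean h x)] `<=` A e n.
    case: n => // n _ x Bx; rewrite AE leNgt; apply/negP => ex; apply: BV0.
    by exists (empirical_mean h x); split => //; apply: eV => //; exact: BY.
  apply: (@squeeze_cvgr _ _ _ _ (cst 0)
      (fun n => cond_prob (power_measure mu n) (A e n) (C n))).
  - near=> n; rewrite cond_prob_ge0/=; apply: cond_prob_le.
    + exact: mB.
    + exact: mA.
    + exact: mC.
    by apply: BA; near: n; exact: nbhs_infty_gt.
  - exact: cvg_cst.
  - exact: lim.
have [pos lim] := conc e e0.
have BA n : (0 < n)%N -> ~` [set x : n.-tuple (borelType X) |
    B (empirical_mean h x)] `<=` A e n.
  case: n => // n _ x /= nBx; rewrite AE leNgt; apply/negP => ex; apply: nBx.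
  by apply: eB => //; rewrite /Y/= in_itv/=; exact: empirical_mean_itv.
apply: (@squeeze_cvgr _ _ _ _ (fun n => 1 -
    cond_prob (power_measure mu n) (A e n) (C n)) (cst 1)).
- near=> n.
  (* The complement rule fails for the default value 0 of [cond_prob], hence the need for positivity
     at large [n]. *)
  have C0 : 0 < fine (power_measure mu n (C n)) by near: n.
  rewrite /p (cond_probC (mB n) (mC n) C0).
  rewrite lerB//= ?gerBl ?cond_prob_ge0//.
  apply: cond_prob_le; [exact: (measurableC (mB n))|exact: mA|exact: mC|].
  by apply: BA; near: n; exact: nbhs_infty_gt.
- rewrite -[X in _ --> X]subr0; apply: cvgB; first exact: cvg_cst.
  exact: lim.
- exact: cvg_cst.
Unshelve. all: by end_near. Qed.
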